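(* Consider the cylindrical reservoir, the flow regimes D, F, FDD, DDpD, FDpD, and the pseudo-steady state productivity index $J$ described in the context. Let $L=2\pi h(r_e^2-r_w^2)^2$ and, for $r_w\le r_1\le r_2\le r_e$, let $$S_D[r_1,r_2]=\alpha\int_{r_1}^{r_2}(r_e^2-r^2)^2r^{-1}\,dr,$$ $$S_F[r_1,r_2]=\int_{r_1}^{r_2}\left[\alpha+\beta A\,(r_e^2-r^2)r^{-1}\right](r_e^2-r^2)^2r^{-1}\,dr,$$ $$S_{pD}[r_1,r_2]=\lambda A^{-s}\int_{r_1}^{r_2}(r_e^2-r^2)^{2-s}r^{s-1}\,dr,\qquad\text{with } A=\frac{Q}{2\pi h(r_e^2-r_w^2)}.$$ Then the productivity index is given by: (1) for Darcy flow in all three zones, $$J_D=\frac{L}{S_D[r_w,r_e]};$$ (2) for Forchheimer flow in all three zones, $$J_F=\frac{L}{S_F[r_w,r_e]};$$ (3) for Forchheimer-Darcy-Darcy flow, $$J_{FDD}=\frac{L}{S_F[r_w,r_F]+S_D[r_F,r_e]};$$ (4) for Darcy-Darcy-pre-Darcy flow, $$J_{DDpD}=\frac{L}{S_D[r_w,r_D]+S_{pD}[r_D,r_e]};$$ (5) for Forchheimer-Darcy-pre-Darcy flow, $$J_{FDpD}=\frac{L}{S_F[r_w,r_F]+S_D[r_F,r_D]+S_{pD}[r_D,r_e]}.$$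
   Context: Geometry and parameters. $U=\{r_w<r<r_e\}$ is a cylindrical reservoir of thickness $h>0$ and radius $r_e$ with a fully penetrated vertical well of radius $r_w$, $0<r_w<r_e$, in its center; $r$ is the distance to the axis; $|U|=\pi h(r_e^2-r_w^2)$. $\Gamma_w=\{r=r_w\}$ is the well surface and $\Gamma_e=\{r=r_e\}$ the impermeable outer boundary. $Q>0$ is the constant well flux (production rate). $\alpha,\beta,\lambda>0$ are the Darcy, Forchheimer and pre-Darcy coefficients, and $0\le s<1$. The compressibility is normalized to $\gamma=1$. Equation of motion. Velocity $u$ and pressure $p$ are related by $g(|u|)u=-\nabla p$, equivalently $u=-K(|\nabla p|)\nabla p$, where at each point $g$ is one of - pre-Darcy: $g(\xi)=\lambda\xi^{-s}$; - Darcy: $g(\xi)=\alpha$; - Forchheimer (post-Darcy): $g(\xi)=\alpha+\beta\xi$. Pseudo-steady state (PSS) and productivity index. The PSS pressure is $p_s(x,t)=-\frac{Q}{|U|}t+B+W(x)$, where $B$ is a constant and the axial-symmetric basic profile $W=W(r)$ solves $$-\frac{Q}{|U|}=\nabla\cdot\bigl(K(|\nabla W|)\nabla W\bigr)\ \text{in } U,\qquad \frac{\partial W}{\partial N}=0\ \text{on }\Gamma_e,\qquad W=0\ \text{on }\Gamma_w .$$ In the axial-symmetric case the speed (the scalar velocity, directed toward the well) is $$v(r)=\frac{A(r_e^2-r^2)}{r}=\frac{Q(r_e^2-r^2)}{2\pi h\, r\,(r_e^2-r_w^2)},\qquad r_w<r<r_e,\qquad A=\frac{Q}{2\pi h(r_e^2-r_w^2)},$$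 and $W$ is continuous on $[r_w,r_e]$ with $W(r_w)=0$ and $W'(r)=g(v(r))\,v(r)$ away from zone interfaces, $g$ being the law valid in the zone containing $r$. The PSS productivity index (PI) is $$J=\frac{Q\,|U|}{\int_U W(x)\,dx}.$$ Zones. $v_D\le v_F$ are the critical transitional velocities (Darcy/pre-Darcy and Forchheimer/Darcy respectively). The radius at which the speed equals $v$ is $$r(v)=\frac{-\pi(r_e^2-r_w^2)v+\sqrt{\pi^2v^2(r_e^2-r_w^2)^2+(Q/h)^2r_e^2}}{Q/h},$$ and $r_D=r(v_D)$, $r_F=r(v_F)$, with $r_w\le r_F\le r_D\le r_e$. The near-well zone is $r_w\le r\le r_F$, the middle zone is $r_F\le r\le r_D$, the near-boundary zone is $r_D\le r\le r_e$. Flow regimes (law used in near-well / middle / near-boundary zone): D: Darcy / Darcy / Darcy; F: Forchheimer / Forchheimer / Forchheimer; FDD: Forchheimer / Darcy / Darcy; DDpD: Darcy / Darcy / pre-Darcy; FDpD: Forchheimer / Darcy / pre-Darcy. $J_D,J_F,J_{FDD},J_{DDpD},J_{FDpD}$ denote the PSS productivity index $J$ for the corresponding regime. *)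

(* Defs.v *)
From HB Require Import structures.
From mathcomp Require Import all_boot all_order all_algebra.
From mathcomp Require Import all_classical all_reals all_analysis.
From mathcomp Require Import ring lra.

Set Implicit Arguments.
Unset Strict Implicit.
Unset Printing Implicit Defensive.

Import Order.TTheory GRing.Theory Num.Theory.
Import numFieldNormedType.Exports.

Local Open Scope classical_set_scope.
Local Open Scope ring_scope.

Record reservoir (R : realType) := Reservoir {
  rw : R;       (* radius of the well *)
  re : R;       (* radius of the outer boundary *)
  thick : R;    (* thickness h *)
  rate : R;     (* well flux Q *)
  alpha : R;    (* Darcy coefficient *)
  beta : R;     (* Forchheimer coefficient *)
  lambda : R;   (* pre-Darcy coefficient *)
  pexp : R;     (* pre-Darcy exponent s *)
  vD : R;       (* critical velocity Darcy / pre-Darcy *)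
  vF : R        (* critical velocity Forchheimer / Darcy *)
}.

Inductive law := PreDarcy | Darcy | Forchheimer.

Record regime := Regime { near_well : law; middle : law; near_boundary : law }.

Definition regD    := Regime Darcy Darcy Darcy.
Definition regF    := Regime Forchheimer Forchheimer Forchheimer.
Definition regFDD  := Regime Forchheimer Darcy Darcy.
Definition regDDpD := Regime Darcy Darcy PreDarcy.
Definition regFDpD := Regime Forchheimer Darcy PreDarcy.

Section Reservoir.
Variables (R : realType) (P : reservoir R).
Implicit Types (r v xi : R) (W : R -> R).

Local Notation mu := (@lebesgue_measure R).

(* Points of space are ((x, y), z), the axis of the well being x = y = 0. *)
Definition axis_dist (p : R * R * R) : R :=
  Num.sqrt (p.1.1 ^+ 2 + p.1.2 ^+ 2).

Definition domainU : set (R * R * R) :=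
  [set p | rw P < axis_dist p < re P /\ 0 < p.2 < thick P].

Local Notation volume3 := ((mu \x mu) \x mu)%E.

Definition volU : R := fine (volume3 domainU).

(* The function g of the equation of motion g(|u|) u = - grad p. *)
Definition drag (l : law) xi : R :=
  match l with
  | PreDarcy => lambda P * xi `^ (- pexp P)
  | Darcy => alpha P
  | Forchheimer => alpha P + beta P * xi
  end.

Definition coefA : R :=
  rate P / (2 * pi * thick P * (re P ^+ 2 - rw P ^+ 2)).

Definition speed r : R := coefA * (re P ^+ 2 - r ^+ 2) / r.

Definition critical_radius v : R :=
  (- pi * (re P ^+ 2 - rw P ^+ 2) * v
   + Num.sqrt (pi ^+ 2 * v ^+ 2 * (re P ^+ 2 - rw P ^+ 2) ^+ 2
               + (rate P / thick P) ^+ 2 * re P ^+ 2))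
  / (rate P / thick P).

Definition rD : R := critical_radius (vD P).
Definition rF : R := critical_radius (vF P).

Definition satisfies_law_on (l : law) W (a b : R) : Prop :=
  forall r, a < r < b -> is_derive r 1 W (drag l (speed r) * speed r).

(* The basic profile, as a function of the distance to the axis; it has a
   kink at an interface where the law changes, hence the open zones. *)
Definition basic_profile (G : regime) W : Prop :=
  [/\ {within `[rw P, re P], continuous W},
      W (rw P) = 0,
      satisfies_law_on (near_well G) W (rw P) rF,
      satisfies_law_on (middle G) W rF rD
    & satisfies_law_on (near_boundary G) W rD (re P)].

Definition productivity_index W : R :=
  rate P * volU / \int[volume3]_(p in domainU) W (axis_dist p).

Definition coefL : R := 2 * pi * thick P * (re P ^+ 2 - rw P ^+ 2) ^+ 2.

Definition SD (r1 r2 : R) : R :=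
  alpha P * \int[mu]_(r in `[r1, r2]) ((re P ^+ 2 - r ^+ 2) ^+ 2 * r^-1).

Definition SF (r1 r2 : R) : R :=
  \int[mu]_(r in `[r1, r2])
    ((alpha P + beta P * coefA * (re P ^+ 2 - r ^+ 2) * r^-1)
     * (re P ^+ 2 - r ^+ 2) ^+ 2 * r^-1).

Definition SpD (r1 r2 : R) : R :=
  lambda P * coefA `^ (- pexp P)
  * \int[mu]_(r in `[r1, r2])
      ((re P ^+ 2 - r ^+ 2) `^ (2 - pexp P) * r `^ (pexp P - 1)).

(* The formula for the speed is the axially symmetric mass balance: the flux
   speed(r) e_r has divergence (r speed(r))' / r = - Q / |U|, with
   2 A = Q / (pi h (re^2 - rw^2)), and it vanishes on the outer boundary. *)
Lemma speed_mass_balance r : 0 < r ->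
  is_derive r 1 (fun x => x * speed x) (- (2 * coefA) * r).
Proof.
move=> r0.
apply: (near_eq_is_derive
  (f := fun x : R^o => (coefA * re P ^+ 2 - coefA * (x * x) : R^o))).
- near=> x; have x0 : 0 < x by near: x; exact: lt_nbhsr.
  by rewrite /speed; field; rewrite gt_eqF.
- by apply: is_derive_eq; rewrite /GRing.scale/=; ring.
Unshelve. all: by end_near. Qed.

Lemma speed_re : speed (re P) = 0.
Proof. by rewrite /speed subrr mulr0 mul0r. Qed.

End Reservoir.

(* Main.v *)
From HB Require Import structures.
Require Import Defs.
From mathcomp Require Import all_boot all_order all_algebra.
From mathcomp Require Import all_classical all_reals all_analysis.
From mathcomp Require Import measurable_realfun ring lra.

Set Implicit Arguments.
Unset Strict Implicit.
Unset Printing Implicit Defensive.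

Import Order.TTheory GRing.Theory Num.Theory.
Import numFieldNormedType.Exports.
Local Open Scope classical_set_scope.
Local Open Scope ring_scope.

(** Why the formulas hold.  In a zone [a, b] where the law has resistance g,
  the profile has slope f = g(v) v, so that it gains
     W(min(b, max(a, rho))) - W(a) = int_a^min(b, rho) f(r) dr
  between the well and the radius rho.  Integrate this over U and exchange
  the two integrations: the radius r is then weighted by the volume of the
  part of U lying beyond r, a cylindrical shell of volume
  pi h (re^2 - r^2).  Hence the zone contributes
     pi h int_a^b f(r) (re^2 - r^2) dr
  to the integral of W over U.  As re^2 - r^2 = r v(r) / A, the integrand is
  A times the one of S_D, S_F or S_pD, according to the law
  (Rintegral_weighted_slope), and the contribution is pi h A S (integral_gain).
  Tonelli's theorem thus does the work of polar coordinates followed by an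
  integration by parts (layer_cake_shell).

  For a point of U the gains of the three zones telescope to W(rho), hence
  the integral of W over U is pi h A (S_1 + S_2 + S_3), and
  Q |U| / (pi h A) = 2 pi h (re^2 - rw^2)^2 = L
  (productivity_index_zones).  The five regimes are instances; when adjacent
  zones follow the same law their sums merge by zone_sum_split.

  The only geometric input is the area of a disk (disk_area).  Its vertical
  chords have length 2 sqrt(r^2 - x^2), for which circle_prim is an
  antiderivative. *)

(** * Area of a disk *)

Section chord.
Context {R : realType}.
Implicit Types (r x : R).
Local Notation mu := (@lebesgue_measure R).

(** The derivative is prescribed inside the interval, with mere continuity at
  its ends: this covers both circle_prim, whose derivative formula fails at
  the ends, and the basic profile, which has kinks there. *)
Lemma FTC2_is_derive (f F : R -> R) (a b : R) : a < b ->
  {within `[a, b], continuous f} -> {within `[a, b], continuous F} ->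
  (forall x, a < x < b -> is_derive x 1 F (f x)) ->
  (\int[mu]_(x in `[a, b]) (f x)%:E = (F b - F a)%:E)%E.
Proof.
move=> ab cf /(continuous_within_itvP _ ab)[_ Fa Fb] dF.
rewrite (@continuous_FTC2 _ f F)//.
- by split=> // x; rewrite in_itv/= => /dF[].
- by move=> x; rewrite in_itv/= => xab; rewrite derive1E; have [_] := dF _ xab.
Qed.

(** The usual antiderivative of the chord length, with the half-angle form
  2 atan (x / (r + sqrt (r^2 - x^2))) of asin (x / r): unlike asin, it is a
  composition of functions continuous at x = r and x = -r as well. *)
Definition circle_prim r x : R :=
  x * Num.sqrt (r ^+ 2 - x ^+ 2)
  + 2 * r ^+ 2 * atan (x / (r + Num.sqrt (r ^+ 2 - x ^+ 2))).

Lemma continuous_half_chord r :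
  continuous (fun x => Num.sqrt (r ^+ 2 - x ^+ 2)).
Proof.
move=> x; apply: continuous_comp; last exact: sqrt_continuous.
by apply: cvgB; [exact: cvg_cst|exact: exprn_continuous].
Qed.

Lemma continuous_circle_prim r : 0 < r -> continuous (circle_prim r).
Proof.
move=> r0 x; have cs := @continuous_half_chord r x.
apply: cvgD; first by apply: cvgM => //; exact: cvg_id.
apply: cvgM; first exact: cvg_cst.
apply: continuous_comp; last exact: continuous_atan.
apply: cvgM; first exact: cvg_id.
apply: cvgV; first by rewrite gt_eqF// ltr_wpDr// sqrtr_ge0.
by apply: cvgD => //; exact: cvg_cst.
Qed.

Lemma is_derive_circle_prim r x : - r < x < r ->
  is_derive x 1 (circle_prim r) (2 * Num.sqrt (r ^+ 2 - x ^+ 2)).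
Proof.
move=> /andP[rx xr].
have c0 : 0 < r ^+ 2 - x ^+ 2 by nra.
have r0 : 0 < r by lra.
have s0 : 0 < Num.sqrt (r ^+ 2 - x ^+ 2) by rewrite sqrtr_gt0.
have q0 : r + Num.sqrt (r ^+ 2 - x ^+ 2) != 0 by rewrite gt_eqF// addr_gt0.
have dc : is_derive x 1 (fun y => r ^+ 2 - y ^+ 2) (- (2 * x)).
  by apply: is_derive_eq; rewrite /GRing.scale/=; ring.
pose s y : R := Num.sqrt (r ^+ 2 - y ^+ 2).
have ds : is_derive x 1 s (- x / s x).
  have := @is_derive1_comp _ Num.sqrt (fun y => r ^+ 2 - y ^+ 2) x _ _
    (is_derive1_sqrt c0) dc.
  move=> /is_derive_eq; apply.
  rewrite -/(s x); field; exact: lt0r_neq0.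
have dq : is_derive x 1 (fun y => y * (r + s y)^-1) (r / (s x * (r + s x))).
  have dV := @is_deriveV _ (fun y => r + s y) x _ 1 q0
    (is_deriveD (is_derive_cst r x 1) ds).
  have := is_deriveM (is_derive_id x 1) dV.
  move=> /is_derive_eq; apply.
  rewrite /GRing.scale/= -/(s x).
  have s2 : s x ^+ 2 = r ^+ 2 - x ^+ 2 by rewrite sqr_sqrtr// ltW.
  have : x ^+ 2 = r ^+ 2 - s x ^+ 2 by rewrite s2; ring.
  move: q0 (lt0r_neq0 s0); rewrite -/(s x).
  move: (s x) => t t0 t1 xt.
  rewrite add0r.
  transitivity ((r + t)^-1 + x ^+ 2 * ((r + t) ^- 2 / t)).
    by field; rewrite t0 t1.
  by rewrite xt; field; rewrite t0 t1.
have da := @is_derive1_comp _ atan (fun y => y * (r + s y)^-1) x _ _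
  (is_derive1_atan _) dq.
have := is_deriveD (is_deriveM (is_derive_id x 1) ds)
  (is_deriveZ (2 * r ^+ 2) da).
move=> /is_derive_eq; apply.
rewrite /GRing.scale/= -/(s x).
have s2 : s x ^+ 2 = r ^+ 2 - x ^+ 2 by rewrite sqr_sqrtr// ltW.
have xt : x ^+ 2 = r ^+ 2 - s x ^+ 2 by rewrite s2; ring.
move: q0 (lt0r_neq0 s0); rewrite -/(s x).
move: (s x) xt => t xt t0 t1.
(* With t = sqrt (r^2 - x^2), every x^2 is replaced by r^2 - t^2; what
   remains are rational identities in r and t. *)
have -> : 1 + (x / (r + t)) ^+ 2 = 2 * r / (r + t).
  transitivity (1 + x ^+ 2 / (r + t) ^+ 2); first by field.
  by rewrite xt; field.
transitivity (t - x ^+ 2 / t + r ^+ 2 / t).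
  by field; rewrite t0 t1 gt_eqF.
rewrite xt; field; exact: t1.
Qed.

Lemma integral_chord r : 0 < r ->
  (\int[mu]_(x in `[(- r)%R, r]) (2 * Num.sqrt (r ^+ 2 - x ^+ 2))%:E
   = (pi * r ^+ 2)%:E)%E.
Proof.
move=> r0.
have -> : pi * r ^+ 2 = circle_prim r r - circle_prim r (- r).
  rewrite /circle_prim sqrrN subrr sqrtr0 !mulr0 !addr0 mulNr divff ?gt_eqF//.
  by rewrite atanN atan1; field.
apply: FTC2_is_derive; first lra.
- apply: continuous_subspaceT => x; apply: cvgM; first exact: cvg_cst.
  exact: continuous_half_chord.
- exact/continuous_subspaceT/continuous_circle_prim.
- by move=> x; exact: is_derive_circle_prim.
Qed.
End chord.

Section disk.
Context {R : realType}.
Implicit Types (r x y c : R) (b : bool).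
Local Notation mu := (@lebesgue_measure R).

Definition norm2 (q : R * R) : R := Num.sqrt (q.1 ^+ 2 + q.2 ^+ 2).

Lemma measurable_norm2 : measurable_fun setT norm2.
Proof.
apply: (@measurableT_comp _ _ _ _ _ _ (@Num.sqrt R)).
  exact: continuous_measurable_fun (@sqrt_continuous R).
by apply: measurable_funD; apply: measurable_funX;
  [exact: measurable_fst|exact: measurable_snd].
Qed.

(** The closed disk when b holds, the open one otherwise. *)
Definition disk b r : set (R * R) := [set q | norm2 q < r ?<= if b].

Lemma measurable_disk b r : measurable (disk b r).
Proof.
rewrite (_ : disk b r = norm2 @^-1` [set` Interval -oo%O (BSide (~~ b) r)]).
  by rewrite -[X in measurable X]setTI; exact: measurable_norm2.
by apply/seteqP; split=> q; rewrite /disk/= in_itv/= negbK.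
Qed.

Lemma lteif_sqr b x y : 0 <= x -> 0 <= y ->
  (x ^+ 2 < y ^+ 2 ?<= if b) = (x < y ?<= if b).
Proof.
by move=> x0 y0; case: b => /=; rewrite ?ler_pXn2r ?ltr_pXn2r// nnegrE.
Qed.

(** For c < 0 the set is empty and the square root is 0. *)
Lemma lebesgue_measure_sqr_lt b c :
  mu [set y | y ^+ 2 < c ?<= if b] = (2 * Num.sqrt c)%:E.
Proof.
have [c0|c0] := ltP c 0.
  rewrite ltr0_sqrtr// mulr0 (_ : [set _ | _] = set0) ?measure0//.
  apply/seteqP; split=> y //= /lteifW; rewrite leNgt.
  by rewrite (lt_le_trans c0)// sqr_ge0.
rewrite (_ : [set _ | _] =
   [set` Interval (BSide b (- Num.sqrt c)) (BSide (~~ b) (Num.sqrt c))]).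
  rewrite lebesgue_measure_itv/= lte_fin -EFinB.
  by case: ltP => cc; congr EFin; have := sqrtr_ge0 c; lra.
apply/seteqP; split=> y /=; rewrite in_itv/= negbK -lteif_norml.
all: rewrite -(@lteif_sqr _ `|y|) ?sqrtr_ge0// sqr_sqrtr//
   real_normK ?num_real//.
Qed.

Lemma disk_area b r : 0 < r -> (mu \x mu)%E (disk b r) = (pi * r ^+ 2)%:E.
Proof.
move=> r0; rewrite -integral_chord// /product_measure1 [RHS]integral_mkcond.
apply: eq_integral => x _ /=.
rewrite (_ : xsection _ _ =
    [set y | y ^+ 2 < r ^+ 2 - x ^+ 2 ?<= if b]); last first.
  rewrite /xsection /disk; apply/seteqP; split=> y /=; rewrite inE/=;
  rewrite -(@lteif_sqr b (norm2 (x, y)) r) ?sqrtr_ge0// ?ltW//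
    sqr_sqrtr ?addr_ge0 ?sqr_ge0//=;
  by rewrite lteifBrDr addrC.
rewrite lebesgue_measure_sqr_lt patchE; case: ifPn => // /negP xr.
rewrite ler0_sqrtr ?mulr0//.
rewrite leNgt; apply/negP => c0; apply: xr; rewrite inE/= in_itv/= -ler_norml.
rewrite -ler_sqr ?nnegrE// ?ltW// real_normK ?num_real//; lra.
Qed.
End disk.

(** * Integrals of radial functions over a cylindrical shell *)

Section product_sigma_finite.
Context d1 d2 (T1 : measurableType d1) (T2 : measurableType d2) (R : realType).
Variable m1 : {sigma_finite_measure set T1 -> \bar R}.
Variable m2 : {sigma_finite_measure set T2 -> \bar R}.

(** The bundled form of the product measure that Tonelli's theorem expects.
  The instances are named because unification on a product of measures
  selects the instance for products of subprobabilities. *)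
Definition sigma_finite_product :
    {sigma_finite_measure set (T1 * T2)%type -> \bar R} :=
  HB.pack (product_measure1 m1 m2)
    (lebesgue_integral_fubini.measure_function_Measure_isSigmaFinite__to__measure_function_isSFinite
       m1 m2)
    (lebesgue_integral_fubini.measure_function_Measure_isSigmaFinite__to__measure_function_isSigmaFinite
       m1 m2).

End product_sigma_finite.
Arguments sigma_finite_product {d1 d2 T1 T2 R} m1 m2.

Section shell.
Context {R : realType}.
Implicit Types (r x y c h : R) (b : bool).
Local Notation mu := (@lebesgue_measure R).
Local Notation vol := ((mu \x mu) \x mu)%E.

Lemma annulus_area b a c : 0 < a -> a < c ?<= if b ->
  (mu \x mu)%E (disk false c `\` disk (~~ b) a)
  = (pi * (c ^+ 2 - a ^+ 2))%:E.
Proof.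
move=> a0 ac; have c0 : 0 < c by rewrite (lt_le_trans a0)// (lteifW ac).
rewrite measureD; [|exact: measurable_disk..|].
  rewrite (_ : _ `&` _ = disk (~~ b) a).
    by rewrite /= !disk_area// -EFinB mulrBr.
  apply/setIidPr => q; rewrite /disk/=.
  by case: b ac => /= ac qa; [exact: lt_le_trans ac|exact: le_lt_trans ac].
by rewrite /= disk_area// ltry.
Qed.

(** The boolean b tells whether the inner cylinder belongs to the shell; the
  outer one never does. *)
Definition shell b a c h : set (R * R * R) :=
  [set p | ((a < norm2 p.1 ?<= if b) && (norm2 p.1 < c)) /\ 0 < p.2 < h].

Lemma shellE b a c h :
  shell b a c h = (disk false c `\` disk (~~ b) a) `*` `]0, h[.
Proof.
apply/seteqP; split=> p; rewrite /shell /disk/= in_itv/= lteifNE.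
  by move=> [/andP[-> ->] ->].
by move=> [[-> /negP]]; rewrite negbK => ->.
Qed.

Lemma measurable_shell b a c h : measurable (shell b a c h).
Proof.
rewrite shellE; apply: measurableX => //.
by apply: measurableD; exact: measurable_disk.
Qed.

Lemma shell_volume b a c h : 0 < a -> a < c ?<= if b -> 0 < h ->
  vol (shell b a c h) = (pi * h * (c ^+ 2 - a ^+ 2))%:E.
Proof.
move=> a0 ac h0; rewrite shellE product_measure1E//; last first.
  by apply: measurableD; exact: measurable_disk.
rewrite /= annulus_area// lebesgue_measure_itv/= lte_fin h0 -EFinB -EFinM.
by congr EFin; ring.
Qed.

(** Exchanging the integrations, the radius r is weighted by the volume of the
  points of the shell whose distance to the axis is at least r. *)
Lemma layer_cake_shell (f : R -> R) a c h r1 r2 :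
  0 < a -> a < c -> 0 < h -> a <= r1 -> r2 <= c ->
  measurable_fun `[r1, r2] f -> {in `[r1, r2], forall r, 0 <= f r} ->
  (\int[vol]_(p in shell false a c h)
     \int[mu]_(r in `[r1, Num.min r2 (norm2 p.1)]) (f r)%:E
  = \int[mu]_(r in `[r1, r2]) (f r * (pi * h * (c ^+ 2 - r ^+ 2)))%:E)%E.
Proof.
move=> a0 ac h0 ar1 r2c mf f0.
pose S : set ((R * R * R) * R) :=
  [set u | shell false a c h u.1 /\ u.2 <= norm2 u.1.1].
pose g := f \_ `[r1, r2].
have g0 r : 0 <= g r.
  by rewrite /g patchE; case: ifPn => // /set_mem; exact: f0.
have mg : measurable_fun setT g.
  by apply/(measurable_restrictT _ _).1 => //; exact: measurable_itv.
have mS : measurable S.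
  rewrite (_ : S = (shell false a c h `*` setT) `&`
      ((fun u => norm2 u.1.1 - u.2) @^-1` `[0, +oo[)); last first.
    apply/seteqP; split=> u; rewrite /S/= in_itv/= andbT subr_ge0; tauto.
  apply: measurableI.
    by apply: measurableX => //; exact: measurable_shell.
  rewrite -[X in measurable X]setTI.
  have : measurable_fun setT (fun u : (R * R * R) * R => norm2 u.1.1 - u.2).
    apply: measurable_funB; last exact: measurable_snd.
    apply: (measurableT_comp measurable_norm2).
    apply: (measurableT_comp measurable_fst); exact: measurable_fst.
  exact.
pose F (u : (R * R * R) * R) : \bar R := (g u.2 * \1_S u)%:E.
have mF : measurable_fun setT F.
  apply/measurable_EFinP; apply: measurable_funM.
    by apply: measurableT_comp => //; exact: measurable_snd.
  exact: measurable_indic.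
have F0 u : (0 <= F u)%E by rewrite lee_fin mulr_ge0.
rewrite integral_mkcond [RHS]integral_mkcond.
transitivity (\int[vol]_p \int[mu]_r F (p, r))%E.
  apply: eq_integral => p _; rewrite patchE; case: ifPn => pU.
    rewrite integral_mkcond; apply: eq_integral => r _.
    rewrite /F /g/= indicE !patchE.
    rewrite (_ : (r \in [set` `[r1, Num.min r2 (norm2 p.1)]]) =
        (r \in [set` `[r1, r2]]) && ((p, r) \in S)).
      by case: (r \in _); case: (_ \in S); rewrite /= ?mulr1 ?mul0r ?mulr0.
    apply/idP/andP => [|[]]; rewrite !inE/= !in_itv/= le_min.
      move=> /andP[-> /andP[-> rp]]; split=> //.
      by split=> //; exact/set_mem.
    by move=> /andP[-> ->] [].
  rewrite integral0_eq// => r _.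
  rewrite /F/= indicE memNset ?mulr0// => -[/= pS _].
  by move/negP: pU; apply; exact/mem_set.
rewrite [LHS](fubini_tonelli
  (m1 := sigma_finite_product (sigma_finite_product mu mu) mu) (m2 := mu) F)//.
apply: eq_integral => r _.
rewrite patchE /F/=; case: ifPn => rab; last first.
  by rewrite integral0_eq// => p _; rewrite /g patchE (negbTE rab) mul0r.
have mSr : measurable [set p | S (p, r)].
  rewrite (_ : [set p | _] = ysection S r); first exact: measurable_ysection.
  by apply/seteqP; split=> p; rewrite /ysection/= inE.
rewrite (_ : (fun p => _) =
    fun p => (g r)%:E * (\1_[set p | S (p, r)] p)%:E)%E; last first.
  by apply/funext => p; rewrite EFinM !indicE.
rewrite ge0_integralZl_EFin//.
- rewrite integral_indic// setIT.
  have gr : g r = f r by rewrite /g patchE rab.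
  move: rab; rewrite inE/= in_itv/= => /andP[r1r rr2].
  (* The points beyond r form a shell containing its inner cylinder, except
     for r = a, where they form the whole shell. *)
  have [ar|ra] := ltP a r.
  - rewrite (_ : [set p | S (p, r)] = shell true r c h).
      rewrite /= shell_volume//=; last 2 first.
        exact: lt_trans ar.
        exact: le_trans r2c.
      by rewrite gr -EFinM.
    apply/seteqP; split=> p; rewrite /S /shell/=.
      by move=> [[/andP[_ ->] ->] ->].
    by move=> [/andP[rp ->] ->]; rewrite rp (lt_le_trans ar).
  - have {ra}ra : r = a by apply/eqP; rewrite eq_le ra (le_trans ar1).
    rewrite (_ : [set p | S (p, r)] = shell false a c h).
      by rewrite /= shell_volume//= gr ra -EFinM.
    apply/seteqP; split=> p; rewrite /S /shell/= ?ra; first by case.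
    by move=> pS; split=> //; case: pS => /andP[/ltW].
- by apply/measurable_EFinP; exact: measurable_indic.
Qed.
End shell.

(** * One-variable analysis *)

(** For negative v the power v `^ p is 1, hence the absolute value: with it the
  function is continuous at 0 from both sides. *)
Lemma continuous_powR_norm {R : realType} (p : R) : 0 < p ->
  continuous (fun v : R => `|v| `^ p).
Proof.
move=> p0 v; have [->|v0] := eqVneq v 0.
  apply/cvgrPdist_lt => e e0.
  rewrite normr0 powR0 ?gt_eqF//; near=> t.
  rewrite sub0r normrN ger0_norm ?powR_ge0//.
  have -> : e = (e `^ p^-1) `^ p.
    by rewrite -powRrM mulVf ?gt_eqF// powRr1// ltW.
  rewrite gt0_ltr_powR// ?nnegrE ?powR_ge0//.
  near: t; apply: (@nbhs0_lt R R^o); exact: powR_gt0.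
have v0' : 0 < `|v| by rewrite normr_gt0.
apply: (@continuous_comp _ _ _ (@Num.norm _ R) (@powR R ^~ p)).
  exact: norm_continuous.
have := @derivable_powR R 1 p `|v|.
rewrite in_itv/= andbT => /(_ v0') /derivable1_diffP.
exact: differentiable_continuous.
Unshelve. all: by end_near. Qed.

Section Rintegral_lemmas.
Context {R : realType}.
Local Notation mu := (@lebesgue_measure R).

(** Integrability is required of the left-hand integrand only: as c != 0,
  that of f follows. *)
Lemma Rintegral_factor (D : set R) (F f : R -> R) c :
  measurable D -> c != 0 -> mu.-integrable D (EFin \o F) ->
  {in D, forall x, F x = c * f x} ->
  \int[mu]_(x in D) F x = c * \int[mu]_(x in D) f x.
Proof.
move=> mD c0 iF Ff.
rewrite (@eq_Rintegral _ _ _ mu D (fun x => c^-1 * F x) f) => [|x xD].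
  by rewrite RintegralZl// mulVKf.
by rewrite Ff// mulKf.
Qed.

Lemma continuous_Rintegral_split (f : R -> R) a b c : a <= b -> b <= c ->
  {within `[a, c], continuous f} ->
  \int[mu]_(x in `[a, c]) f x
  = \int[mu]_(x in `[a, b]) f x + \int[mu]_(x in `[b, c]) f x.
Proof.
move=> ab bc cf.
have If : mu.-integrable `[a, c] (EFin \o f).
  by apply: continuous_compact_integrable => //; exact: segment_compact.
rewrite -(Rintegral_itv_obnd_cbnd (r := b)).
  by rewrite -(Rintegral_itvB If)/= ?bnd_simp// addrC subrK.
apply: integrableS If => //; apply: subset_itvr; by rewrite bnd_simp.
Qed.
End Rintegral_lemmas.

(** * The contribution of one zone *)

Section zone.
Context {R : realType} (P : reservoir R).
Hypotheses (h_rw : 0 < rw P) (h_re : rw P < re P) (h_thick : 0 < thick P)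
  (h_rate : 0 < rate P)
  (h_alpha : 0 < alpha P) (h_beta : 0 < beta P) (h_lambda : 0 < lambda P)
  (h_s : 0 <= pexp P < 1).
Implicit Types (l : law) (r a b : R) (W : R -> R).
Local Notation mu := (@lebesgue_measure R).
Local Notation volume3 := ((mu \x mu) \x mu)%E.

(** The slope W' prescribed by the law l. *)
Definition slope l r : R := drag P l (speed P r) * speed P r.

Definition zone_sum l a b : R :=
  match l with
  | PreDarcy => SpD P a b
  | Darcy => SD P a b
  | Forchheimer => SF P a b
  end.

Lemma coefA_gt0 : 0 < coefA P.
Proof.
apply: divr_gt0 => //; rewrite !mulr_gt0 ?pi_gt0// subr_gt0.
by rewrite ltr_pXn2r ?nnegrE// ltW// (lt_trans h_rw).
Qed.

Lemma sqr_gap_ge0 r : 0 < r -> r <= re P -> 0 <= re P ^+ 2 - r ^+ 2.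
Proof.
move=> r0 rr; rewrite subr_ge0 ler_pXn2r ?nnegrE ?(ltW r0)//.
exact: le_trans (ltW r0) rr.
Qed.

Lemma speed_ge0 r : 0 < r -> r <= re P -> 0 <= speed P r.
Proof.
move=> r0 rr; rewrite /speed pmulr_lge0 ?invr_gt0//.
by rewrite pmulr_rge0 ?coefA_gt0// sqr_gap_ge0.
Qed.

Lemma slope_ge0 l r : 0 < r -> r <= re P -> 0 <= slope l r.
Proof.
move=> r0 rr; have v0 := speed_ge0 r0 rr.
rewrite mulr_ge0//; case: l => /=.
- by rewrite mulr_ge0 ?powR_ge0// ltW.
- exact: ltW.
- by rewrite (addr_ge0 (ltW h_alpha))// mulr_ge0// ltW.
Qed.

Lemma continuous_speed r : 0 < r -> {for r, continuous (speed P)}.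
Proof.
move=> r0; apply: cvgM; last by apply: cvgV; [rewrite gt_eqF|exact: cvg_id].
apply: cvgM; first exact: cvg_cst.
by apply: cvgB; [exact: cvg_cst|exact: exprn_continuous].
Qed.

(** This form shows the continuity of the slope up to the outer boundary, where
  the speed vanishes and, for s > 0, the resistance v^(-s) is unbounded. *)
Lemma slope_PreDarcyE r : 0 < r -> r <= re P ->
  slope PreDarcy r = lambda P * `|speed P r| `^ (1 - pexp P).
Proof.
move=> r0 rr; rewrite /slope/= -mulrA; congr (_ * _).
have v0 := speed_ge0 r0 rr; rewrite (ger0_norm v0).
have /andP[s0 s1] := h_s.
have [->|vN0] := eqVneq (speed P r) 0.
  by rewrite mulr0 powR0// subr_eq0 gt_eqF.
by rewrite addrC powRD ?vN0 ?implybT// powRr1.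
Qed.

Lemma continuous_slope l a b : 0 < a -> b <= re P ->
  {within `[a, b], continuous (slope l)}.
Proof.
move=> a0 br.
have sub r : r \in `[a, b] -> 0 < r /\ r <= re P.
  rewrite in_itv/= => /andP[ar rb].
  by rewrite (lt_le_trans a0 ar) (le_trans rb br).
case: l.
- apply: (@subspace_eq_continuous _ _ _
    (fun r => lambda P * `|speed P r| `^ (1 - pexp P))).
    by move=> r /set_mem/sub[r0 rr] /=; apply/esym; exact: slope_PreDarcyE.
  apply: continuous_in_subspaceT => r /set_mem/sub[r0 rr].
  apply: cvgM; first exact: cvg_cst.
  apply: (@continuous_comp _ _ _ (speed P) (fun v => `|v| `^ (1 - pexp P))).
    exact: continuous_speed.
  by apply: continuous_powR_norm; rewrite subr_gt0; have /andP[] := h_s.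
- apply: continuous_in_subspaceT => r /set_mem/sub[r0 rr].
  by apply: cvgM; [exact: cvg_cst|exact: continuous_speed].
- apply: continuous_in_subspaceT => r /set_mem/sub[r0 rr].
  apply: cvgM; last exact: continuous_speed.
  apply: cvgD; first exact: cvg_cst.
  by apply: cvgM; [exact: cvg_cst|exact: continuous_speed].
Qed.

Lemma continuous_weighted_slope l a b : 0 < a -> b <= re P ->
  {within `[a, b], continuous (fun r => slope l r * (re P ^+ 2 - r ^+ 2))}.
Proof.
move=> a0 br.
have cd : {within `[a, b], continuous (fun r => re P ^+ 2 - r ^+ 2)}.
  apply: continuous_subspaceT => r.
  by apply: cvgB; [exact: cvg_cst|exact: exprn_continuous].
move=> r; apply: cvgM; [exact: continuous_slope|exact: cd].
Qed.

(** As speed r = A (re^2 - r^2) / r, the weighted slope g(v) v (re^2 - r^2) is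
  A g(v) (re^2 - r^2)^2 / r. *)
Lemma Rintegral_weighted_slope l a b : 0 < a -> b <= re P ->
  \int[mu]_(r in `[a, b]) (slope l r * (re P ^+ 2 - r ^+ 2))
  = coefA P * zone_sum l a b.
Proof.
move=> a0 br.
have i : mu.-integrable `[a, b]
    (EFin \o (fun r => slope l r * (re P ^+ 2 - r ^+ 2))).
  apply: continuous_compact_integrable; first exact: segment_compact.
  exact: continuous_weighted_slope.
have A0 := coefA_gt0; case: l i => i /=.
- rewrite /SpD mulrA; apply: Rintegral_factor => //.
    exact: lt0r_neq0 (mulr_gt0 A0 (mulr_gt0 h_lambda (powR_gt0 _ A0))).
  move=> r; rewrite inE/= in_itv/= => /andP[ar rb].
  have r0 := lt_le_trans a0 ar; have := sqr_gap_ge0 r0 (le_trans rb br).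
  rewrite /slope/= /speed; set d := _ - r ^+ 2.
  rewrite le_eqVlt => /predU1P[<-|d0].
    (* At r = re both sides vanish, the right one because 2 - s > 0. *)
    rewrite powR0 ?mulr0 ?mul0r//; have /andP[_ s1] := h_s; lra.
  have dd : d != 0 by rewrite gt_eqF.
  have rr0 : r != 0 by rewrite gt_eqF.
  have v0 : 0 <= r^-1 by rewrite invr_ge0 ltW.
  rewrite powRM ?(mulr_ge0 (ltW A0) (ltW d0))// powRM ?(ltW A0) ?(ltW d0)//.
  have -> : d `^ (2 - pexp P) = d ^+ 2 * d `^ (- pexp P).
    by rewrite powRD ?dd ?implybT// powR_mulrn// ltW.
  have -> : r `^ (pexp P - 1) = r `^ pexp P * r^-1.
    by rewrite powRD ?rr0 ?implybT// powR_inv1// ltW.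
  rewrite -powR_inv1 ?(ltW r0)// -powRrM mulrNN mul1r powR_inv1 ?(ltW r0)//.
  by field.
- rewrite /SD mulrA; apply: Rintegral_factor => //.
    by rewrite mulf_neq0 ?gt_eqF.
  by move=> r _; rewrite /slope/= /speed; ring.
- apply: Rintegral_factor => //; first by rewrite gt_eqF.
  by move=> r _; rewrite /slope/= /speed; ring.
Qed.

(** The increase of W across the zone [a, b] when going out to the radius r:
  0 before the zone, constant after it.  The gains of consecutive zones
  telescope. *)
Definition gain W a b r : R := W (Num.min b (Num.max a r)) - W a.

Lemma gainE l W a b r : 0 < a -> a <= b -> b <= re P ->
  {within `[a, b], continuous W} -> satisfies_law_on P l W a b ->
  (gain W a b r)%:E = (\int[mu]_(t in `[a, Num.min b r]) (slope l t)%:E)%E.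
Proof.
move=> a0 ab br cW dW; rewrite /gain.
have [ra|ar] := ltP r a.
  rewrite (min_idPr ab) subrr set_itv_ge ?integral_set0//.
  by rewrite bnd_simp -ltNge gt_min ra orbT.
set m := Num.min b r.
have mb : m <= b by rewrite ge_min lexx.
have : a <= m by rewrite le_min ab.
rewrite le_eqVlt => /predU1P[<-|am].
  by rewrite subrr set_itv1 integral_set1.
apply/esym/FTC2_is_derive => //.
- by apply: continuous_slope => //; exact: le_trans br.
- by apply: continuous_subspaceW cW; apply: subset_itvl; rewrite bnd_simp.
- move=> x /andP[ax xm]; apply: dW; rewrite ax/=; exact: lt_le_trans mb.
Qed.

Lemma gain_ge0 l W a b r : 0 < a -> a <= b -> b <= re P ->
  {within `[a, b], continuous W} -> satisfies_law_on P l W a b ->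
  0 <= gain W a b r.
Proof.
move=> a0 ab br cW dW; rewrite -lee_fin (gainE r a0 ab br cW dW).
apply: integral_ge0 => t; rewrite /= in_itv/= le_min => /and3P[a_t tb _].
by rewrite lee_fin slope_ge0//; [exact: lt_le_trans a_t|exact: le_trans br].
Qed.

Lemma measurable_gain W a b : a <= b -> {within `[a, b], continuous W} ->
  measurable_fun setT (gain W a b).
Proof.
move=> ab cW; apply: measurable_funB => //.
apply: (@measurable_comp _ _ _ _ _ _ `[a, b]) => //.
- move=> _ [r _ <-]; rewrite /= in_itv/= le_min ab le_max lexx/= ge_min lexx//.
- exact: subspace_continuous_measurable_fun.
- apply: measurable_minr => //; exact: measurable_maxr.
Qed.

Lemma domainUE : domainU P = shell false (rw P) (re P) (thick P).
Proof. by []. Qed.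

Lemma integral_gain l W a b : rw P <= a -> a <= b -> b <= re P ->
  {within `[a, b], continuous W} -> satisfies_law_on P l W a b ->
  (\int[volume3]_(p in domainU P) (gain W a b (axis_dist p))%:E)%E
  = (pi * thick P * coefA P * zone_sum l a b)%:E.
Proof.
move=> wa ab br cW dW; have a0 := lt_le_trans h_rw wa.
under eq_integral do rewrite (gainE _ a0 ab br cW dW).
rewrite domainUE layer_cake_shell//; last 2 first.
- apply: subspace_continuous_measurable_fun => //; exact: continuous_slope.
- move=> r; rewrite in_itv/= => /andP[ar rb].
  by rewrite slope_ge0//; [exact: lt_le_trans ar|exact: le_trans br].
have i : mu.-integrable `[a, b]
    (EFin \o (fun r => slope l r * (re P ^+ 2 - r ^+ 2))).
  apply: continuous_compact_integrable; first exact: segment_compact.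
  exact: continuous_weighted_slope.
rewrite -mulrA -Rintegral_weighted_slope// -RintegralZl//.
rewrite /Rintegral fineK.
  by apply: eq_integral => r _; congr EFin; ring.
rewrite integrable_fin_num//.
exact: (integrableZl _ _ i).
Qed.

(** * The productivity index *)

Lemma volUE : volU P = pi * thick P * (re P ^+ 2 - rw P ^+ 2).
Proof. by rewrite /volU domainUE shell_volume. Qed.

(** The integral of W over U is pi h A times the sum S of the three zone sums,
  and coefL equals Q |U| / (pi h A). *)
Lemma productivity_index_zones G W :
  rw P <= rF P -> rF P <= rD P -> rD P <= re P -> basic_profile P G W ->
  productivity_index P W
  = coefL P / (zone_sum (near_well G) (rw P) (rF P)
               + zone_sum (middle G) (rF P) (rD P)
               + zone_sum (near_boundary G) (rD P) (re P)).
Proof.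
move=> wF FD De [cW W0 d1 d2 d3].
have subW a b : rw P <= a -> b <= re P -> {within `[a, b], continuous W}.
  move=> wa be; apply: continuous_subspaceW cW.
  by apply: subset_itv; rewrite bnd_simp.
have c1 := subW _ _ (lexx _) (le_trans FD De).
have c2 := subW _ _ wF De.
have c3 := subW _ _ (le_trans wF FD) (lexx _).
have F0 := lt_le_trans h_rw wF; have D0 := lt_le_trans F0 FD.
have mU : measurable (domainU P) by rewrite domainUE; exact: measurable_shell.
have madist : measurable_fun (domainU P) (@axis_dist R).
  apply: measurable_funTS.
  exact: (measurableT_comp (@measurable_norm2 R) measurable_fst).
have mg a b : a <= b -> {within `[a, b], continuous W} ->
    measurable_fun (domainU P) (fun p => (gain W a b (axis_dist p))%:E).
  move=> ab cab; apply/measurable_EFinP.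
  exact: (measurableT_comp (measurable_gain ab cab)).
rewrite /productivity_index /Rintegral.
rewrite (_ : (\int[_]_(p in _) _)%E = (pi * thick P * coefA P *
  (zone_sum (near_well G) (rw P) (rF P)
               + zone_sum (middle G) (rF P) (rD P)
               + zone_sum (near_boundary G) (rD P) (re P)))%:E).
  rewrite /= volUE invfM [LHS]mulrA; congr (_ * _).
  have d0 : 0 < re P ^+ 2 - rw P ^+ 2.
    by rewrite subr_gt0 ltr_pXn2r ?nnegrE ?ltW// (lt_trans h_rw).
  rewrite /coefL /coefA; move: pi (pi_gt0 R) => q q0.
  by field; rewrite !gt_eqF.
rewrite !mulrDr !EFinD.
have Fe := le_trans FD De; have wD := le_trans wF FD.
rewrite -(integral_gain (lexx _) wF Fe c1 d1) -(integral_gain wF FD De c2 d2).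
rewrite -(integral_gain wD De (lexx _) c3 d3).
have g1 p : (0 <= (gain W (rw P) (rF P) (axis_dist p))%:E)%E.
  by rewrite lee_fin (gain_ge0 _ h_rw wF Fe c1 d1).
have g2 p : (0 <= (gain W (rF P) (rD P) (axis_dist p))%:E)%E.
  by rewrite lee_fin (gain_ge0 _ F0 FD De c2 d2).
have g3 p : (0 <= (gain W (rD P) (re P) (axis_dist p))%:E)%E.
  by rewrite lee_fin (gain_ge0 _ D0 De (lexx _) c3 d3).
rewrite -ge0_integralD//; [|exact: mg..].
rewrite -ge0_integralD//; [|by move=> p _; rewrite adde_ge0
  |exact: emeasurable_funD (mg _ _ _ _) (mg _ _ _ _)
  |exact: mg].
apply: eq_integral => p; rewrite inE => -[/andP[/ltW wp /ltW pe] _].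
rewrite -!EFinD; congr EFin; rewrite /gain W0 subr0 (max_idPr wp).
have /orP[pF|Fp] := le_total (axis_dist p) (rF P).
  rewrite (max_idPl pF) (min_idPr pF) (min_idPr FD).
  rewrite (max_idPl (le_trans pF FD)) (min_idPr De).
  by rewrite !subrr !addr0.
rewrite (min_idPl Fp) (max_idPr Fp).
have /orP[pD|Dp] := le_total (axis_dist p) (rD P).
  by rewrite (max_idPl pD) (min_idPr pD) (min_idPr De); ring.
by rewrite (max_idPr Dp) (min_idPl Dp) (min_idPr pe); ring.
Qed.

Lemma zone_sum_split l a b c : 0 < a -> a <= b -> b <= c -> c <= re P ->
  zone_sum l a c = zone_sum l a b + zone_sum l b c.
Proof.
move=> a0 ab bc ce; apply: (mulfI (lt0r_neq0 coefA_gt0)).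
rewrite mulrDr -!Rintegral_weighted_slope//; last 2 first.
  exact: lt_le_trans ab.
  exact: le_trans ce.
by apply: continuous_Rintegral_split => //; exact: continuous_weighted_slope.
Qed.

End zone.

Unset Implicit Arguments.

Theorem proposition3p2 (R : realType) (P : reservoir R)
  (h_rw : 0 < rw P) (h_re : rw P < re P) (h_thick : 0 < thick P)
  (h_rate : 0 < rate P)
  (h_alpha : 0 < alpha P) (h_beta : 0 < beta P) (h_lambda : 0 < lambda P)
  (h_s : 0 <= pexp P < 1)
  (h_v : vD P <= vF P)
  (h_zones : rw P <= rF P /\ rF P <= rD P /\ rD P <= re P) :
  (forall W : R -> R, basic_profile P regD W ->
     productivity_index P W = coefL P / SD P (rw P) (re P)) /\
  (forall W : R -> R, basic_profile P regF W ->
     productivity_index P W = coefL P / SF P (rw P) (re P)) /\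
  (forall W : R -> R, basic_profile P regFDD W ->
     productivity_index P W
     = coefL P / (SF P (rw P) (rF P) + SD P (rF P) (re P))) /\
  (forall W : R -> R, basic_profile P regDDpD W ->
     productivity_index P W
     = coefL P / (SD P (rw P) (rD P) + SpD P (rD P) (re P))) /\
  (forall W : R -> R, basic_profile P regFDpD W ->
     productivity_index P W
     = coefL P / (SF P (rw P) (rF P) + SD P (rF P) (rD P)
                  + SpD P (rD P) (re P))).
Proof.
have [wF [FD De]] := h_zones.
have F0 := lt_le_trans h_rw wF; have Fe := le_trans FD De.
have wD := le_trans wF FD.
have PI := productivity_index_zones h_rw h_re h_thick h_rate h_alpha h_beta
  h_lambda h_s wF FD De.
have split l := @zone_sum_split _ P h_rw h_re h_thick h_rate h_alpha h_lambda
  h_s l.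
have splitD := split Darcy; have splitF := split Forchheimer.
rewrite /= in splitD splitF.
split; [|split; [|split; [|split]]] => W /PI -> //=.
- by rewrite (splitD (rw P) (rF P) (re P))//
    (splitD (rF P) (rD P) (re P))// addrA.
- by rewrite (splitF (rw P) (rF P) (re P))//
    (splitF (rF P) (rD P) (re P))// addrA.
- by rewrite (splitD (rF P) (rD P) (re P))// addrA.
- by rewrite (splitD (rw P) (rF P) (rD P)).
Qed.
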